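(* Let $G_1=(V_1,E_1)$ and $G_2=(V_2,E_2)$ be two graphs with clique number at least $r\in\mathbb{N}$. Then for every $r$-gluing $G_1\cup_{K_r}G_2$ of $G_1$ and $G_2$, $$\gamma_{sp}(G_1)+\gamma_{sp}(G_2)-r\leq\gamma_{sp}(G_1\cup_{K_r}G_2)\leq\gamma_{sp}(G_1)+\gamma_{sp}(G_2).$$
   Context: All graphs are finite, simple, undirected; $\mathbb{N}=\{1,2,\dots\}$. For $S\subseteq V(G)$, $\overline{S}=V(G)\setminus S$ and $N(v)$ denotes the open neighbourhood of $v$. A set $S$ is a super dominating set of $G$ if every vertex of $\overline{S}$ has a neighbour in $S$ and for every $u\in\overline{S}$ there is $v\in S$ with $N(v)\cap\overline{S}=\{u\}$. The super domination number $\gamma_{sp}(G)$ is the minimum cardinality of a super dominating set of $G$. Given $r\leq\min\{\omega(G_1),\omega(G_2)\}$ (clique numbers), an $r$-gluing $G_1\cup_{K_r}G_2$ is a graph obtained from the disjoint union of $G_1$ and $G_2$ by choosing an $r$-clique in each of $G_1$ and $G_2$ and identifying the two chosen $r$-cliques vertex-by-vertex in an arbitrary manner. *)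

(* Defs.v *)
From mathcomp Require Import all_boot.
Set Implicit Arguments.
Unset Strict Implicit.
Unset Printing Implicit Defensive.

Record sgraph := SGraph {
  vertex :> finType;
  adj : rel vertex;
  adj_sym : symmetric adj;
  adj_irr : irreflexive adj
}.
Arguments adj {s}.

Section Basics.
Variable G : sgraph.

Definition nbh (v : G) : {set G} := [set w | adj v w].

Definition clique (K : {set G}) : bool :=
  [forall x in K, [forall y in K, (x != y) ==> adj x y]].

Definition clique_number : nat := \max_(K : {set G} | clique K) #|K|.

Definition super_dominating (S : {set G}) : bool :=
  [forall u in ~: S, [exists v in S, adj u v]] &&
  [forall u in ~: S, [exists v in S, nbh v :&: ~: S == [set u]]].

(* The whole vertex set, used as the default of [arg min], is (vacuously) *)
(* super dominating, so the minimum below is never a junk value.          *)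
Definition gamma_sp : nat :=
  #|[arg min_(S < [set: G] | super_dominating S) #|S| ]|.

Lemma super_dominatingT : super_dominating [set: G].
Proof. by apply/andP; split; apply/forall_inP=> u; rewrite !inE. Qed.

Lemma gamma_spP :
  exists2 S, super_dominating S & #|S| = gamma_sp /\
    forall S', super_dominating S' -> gamma_sp <= #|S'|.
Proof.
by rewrite /gamma_sp; case: arg_minnP => [|S hS hmin];
  [exact: super_dominatingT | exists S].
Qed.

End Basics.

Section Gluing.
Variables G1 G2 : sgraph.

Definition disjoint_adj (x y : G1 + G2) : bool :=
  match x, y with
  | inl a, inl b => adj a b
  | inr a, inr b => adj a b
  | _, _ => false
  end.

(* Equality in G1 + G2 up to identifying each a in K1 with phi a; it is an *)
(* equivalence relation as soon as phi is injective on K1.                 *)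
Definition identified (K1 : {set G1}) (phi : G1 -> G2) (x y : G1 + G2) : bool :=
  match x, y with
  | inl a, inl b => a == b
  | inr a, inr b => a == b
  | inl a, inr b => (a \in K1) && (phi a == b)
  | inr b, inl a => (a \in K1) && (phi a == b)
  end.

(* G is, up to isomorphism, the quotient of the disjoint union of G1 and G2 *)
(* by [identified K1 phi], with p the quotient map: two classes are adjacent *)
(* iff they have adjacent representatives.                                   *)
Definition glued_along (K1 : {set G1}) (phi : G1 -> G2) (G : sgraph) : Prop :=
  exists p : G1 + G2 -> G,
    [/\ forall u, exists x, p x = u,
        forall x y, (p x == p y) = identified K1 phi x y
      & forall u v, adj u v <->
          exists x y, [/\ p x = u, p y = v & disjoint_adj x y]].

(* Only the restriction of phi to K1, a bijection onto K2, matters. *)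
Definition is_gluing (r : nat) (G : sgraph) : Prop :=
  exists (K1 : {set G1}) (K2 : {set G2}) (phi : G1 -> G2),
    [/\ clique K1 /\ #|K1| = r,
        clique K2 /\ #|K2| = r,
        {in K1 &, injective phi} /\ phi @: K1 = K2
      & glued_along K1 phi G].

(* Gluings exist for every choice of the cliques and of the bijection. *)
Lemma glued_along_exists (K1 : {set G1}) (phi : G1 -> G2) :
  {in K1 &, injective phi} -> exists G, glued_along K1 phi G.
Proof.
move=> phiI.
pose cls x := [set y | identified K1 phi x y].
have idxx x : identified K1 phi x x by case: x => a /=.
have idC x y : identified K1 phi x y = identified K1 phi y x.
  by case: x y => [a|a] [b|b] //=; rewrite eq_sym.
have idT x y z : identified K1 phi x y -> identified K1 phi y z ->
    identified K1 phi x z.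
  case: x y z => [a|a] [b|b] [c|c] //=; try by move=> /eqP->.
  - move=> /andP[aK /eqP<-] /andP[cK /eqP e]; apply/eqP.
    by apply: phiI => //.
  - by move=> /andP[aK /eqP<-] /eqP<-; rewrite aK eqxx.
  - by move=> /andP[aK /eqP<-] /eqP<-; rewrite aK eqxx.
  - by move=> /andP[_ /eqP<-] /andP[_ /eqP<-].
have clsP x y : (cls x == cls y) = identified K1 phi x y.
  apply/eqP/idP => [e|xy].
    have: y \in cls y by rewrite inE.
    by rewrite -e inE.
  apply/setP=> z; rewrite !inE; apply/idP/idP => [xz|]; last exact: idT.
  by apply: idT xz; rewrite idC.
pose V := {C : {set G1 + G2} | C \in codom cls}.
pose e (u v : V) := [exists x, [exists y,
  [&& cls x == val u, cls y == val v & disjoint_adj x y]]].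
have dC : symmetric disjoint_adj by case=> a [b|b] //=; rewrite adj_sym.
have eS : symmetric e.
  have eS1 u v : e u v -> e v u.
    move=> /existsP[x /existsP[y /and3P[ux vy xy]]].
    by apply/existsP; exists y; apply/existsP; exists x; rewrite vy ux dC.
  by move=> u v; apply/idP/idP; apply: eS1.
have eI : irreflexive e.
  move=> u; apply/negbTE/negP=> /existsP[x /existsP[y /and3P[/eqP ux /eqP uy]]].
  have: identified K1 phi x y by rewrite -clsP ux uy.
  by case: x y {ux uy} => a [b|b] //= /eqP->; rewrite adj_irr.
exists (SGraph eS eI).
exists (fun x => Sub (cls x) (codom_f cls x) : V); split.
- by case=> C hC; have /codomP[x def] := hC; exists x; apply: val_inj.
- by move=> x y; rewrite -val_eqE /= clsP.
move=> u v; split.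
  move=> /existsP [x /existsP[y /and3P[/eqP ? /eqP ? ?]]].
  by exists x, y; split=> //; apply: val_inj.
move=> [x [y [<- <- xy]]]; apply/existsP; exists x; apply/existsP; exists y.
by rewrite !eqxx.
Qed.

End Gluing.

(* Main.v *)
Require Import Defs.
From mathcomp Require Import all_boot.

Set Implicit Arguments.
Unset Strict Implicit.
Unset Printing Implicit Defensive.

(** If [S] is super dominating, each [u] outside [S] has a partner [v] in [S]
    whose only neighbour outside [S] is [u].  Such a family of pairs [(u, v)] is
    the same thing as a matching whose bipartite graph between first and second
    components is induced ("cross matching"), so [gamma_sp G] is [#|G|] minus
    the largest size of a cross matching.  As an [r]-gluing has
    [#|G1| + #|G2| - r] vertices, with [m] this largest size the theorem reads
    [m G <= m G1 + m G2 <= m G + r].  The first inequality holds because every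
    edge of the gluing lies in [G1] or in [G2].  For the second one, cross
    matchings can be flipped by exchanging the two components; after flipping,
    the first components avoid the clique [K], unless [K] contains one pair
    of the matching and meets no other pair.  Deleting at most one pair for each
    vertex of [K] then makes the union of the two matchings a cross matching. *)

(** * Cross matchings and super dominating sets *)

Section CrossMatching.
Variable G : sgraph.
Implicit Types (S K A B : {set G}) (M : {set G * G}) (p q : G * G).

(** The case [p = q] makes each pair an edge, the other cases forbid any further edge between the
    two sides. Edges inside one side are unrestricted. *)
Definition cross_matching M :=
  {in M &, forall p q, p.1 != q.2 /\ adj p.1 q.2 = (p == q)}.

Definition flip M : {set G * G} := [set (p.2, p.1) | p in M].

Lemma card_flip M : #|flip M| = #|M|.
Proof. by rewrite card_imset // => [[a b] [c d]] [-> ->]. Qed.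

Lemma cross_matching_flip M : cross_matching M -> cross_matching (flip M).
Proof.
move=> cM _ _ /imsetP[p pM ->] /imsetP[q qM ->] /=.
have [neq adjE] := cM q p qM pM; rewrite eq_sym neq adj_sym adjE; split=> //.
rewrite eq_sym; case: p q {pM qM neq adjE} => [a b] [c d].
by rewrite !xpair_eqE andbC.
Qed.

Lemma flip_sub M A : M \subset setX A A -> flip M \subset setX A A.
Proof.
move/subsetP=> sM; apply/subsetP=> _ /imsetP[p /sM pA ->].
by move: pA; rewrite !inE andbC.
Qed.

Lemma cross_matching_sub M M' :
  M' \subset M -> cross_matching M -> cross_matching M'.
Proof. by move=> /subsetP s cM p q /s pM /s qM; apply: cM. Qed.

Lemma cross_matching_fst_inj M : cross_matching M -> {in M &, injective fst}.
Proof.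
move=> cM p q pM qM e; apply/eqP.
by rewrite -(cM p q pM qM).2 e (cM q q qM qM).2.
Qed.

Lemma cross_matching_snd_inj M : cross_matching M -> {in M &, injective snd}.
Proof.
move=> cM p q pM qM e; apply/eqP.
by rewrite -(cM p q pM qM).2 -e (cM p p pM pM).2.
Qed.

Lemma super_dominating_cross_matching S :
  super_dominating S -> exists2 M, cross_matching M & #|M| = #|~: S|.
Proof.
move=> /andP[_ /forall_inP sd].
pose P u v := (v \in S) && (nbh v :&: ~: S == [set u]).
(* The default [u] only makes [f] total: by [fP], the [pick] succeeds outside [S]. *)
pose f u := odflt u [pick v | P u v].
have fP u : u \in ~: S -> P u (f u).
  move=> /sd/exists_inP[v vS e]; rewrite /f; case: pickP => [//|/(_ v)].
  by rewrite /P vS e.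
exists [set (u, f u) | u in ~: S]; last by rewrite card_imset // => u v [].
move=> _ _ /imsetP[u uS ->] /imsetP[v vS ->] /=.
have /andP[fS /eqP nb] := fP v vS; split.
  by apply: contraTneq uS => ->; rewrite inE fS.
have /setP/(_ u) := nb; rewrite in_set1 in_setI uS andbT inE adj_sym => ->.
by rewrite xpair_eqE; case: eqP => // ->; rewrite eqxx.
Qed.

(** For a pair [p], the vertex [p.2] lies in the set and has [p.1] as its only neighbour outside, so
    it witnesses both conditions for [p.1]. *)
Lemma cross_matching_super_dominating M :
  cross_matching M -> super_dominating (~: [set p.1 | p in M]).
Proof.
move=> cM; set U := [set p.1 | p in M].
have sndU p : p \in M -> p.2 \in ~: U.
  move=> pM; rewrite inE; apply/imsetP=> -[q qM e].
  by have [] := cM q p qM pM; rewrite e eqxx.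
apply/andP; split; apply/forall_inP=> u; rewrite setCK => /imsetP[p pM ->];
  apply/exists_inP; exists p.2; rewrite ?sndU //.
  by rewrite (cM p p pM pM).2.
apply/eqP/setP=> w; rewrite !inE; apply/andP/eqP => [[pw]|->].
  move=> /imsetP[q qM e]; move: pw; rewrite e adj_sym (cM q p qM pM).2.
  by move/eqP->.
by rewrite adj_sym (cM p p pM pM).2 eqxx; split=> //; apply: imset_f.
Qed.

Lemma gamma_sp_cross_matching_max :
  (exists2 M, cross_matching M & gamma_sp G + #|M| = #|G|) /\
  forall M, cross_matching M -> gamma_sp G + #|M| <= #|G|.
Proof.
have [S sdS [<- minS]] := gamma_spP G; split=> [|M cM].
  have [M cM cardM] := super_dominating_cross_matching sdS.
  by exists M; rewrite // cardM cardsC.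
have := minS _ (cross_matching_super_dominating cM).
rewrite -(cardsC [set p.1 | p in M]) card_in_imset.
  by rewrite addnC leq_add2l.
exact: cross_matching_fst_inj.
Qed.

(** If [p.1] and [q.2] both lie in the clique, they are distinct, hence adjacent, which forces
    [p = q]. So either one side avoids [K], after a flip the first one, or a single pair lies inside
    [K] and no other pair meets it. *)
Lemma cross_matching_normal_form K A M :
  clique K -> cross_matching M -> M \subset setX A A ->
  exists M', [/\ cross_matching M', M' \subset setX A A, #|M'| = #|M|
    & {in M', forall p, p.1 \notin K} \/
      exists2 p0, p0 \in M' /\ (p0.1 \in K /\ p0.2 \in K) &
        {in M', forall p, (p.1 \in K) || (p.2 \in K) -> p = p0}].
Proof.
move=> /forall_inP clK cM sM.
have [/forall_inP fstK|/forall_inPn[p pM /negPn pK]] :=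
    boolP [forall p in M, p.1 \notin K].
  by exists M; split=> //; left.
have [/forall_inP sndK|/forall_inPn[q qM /negPn qK]] :=
    boolP [forall p in M, p.2 \notin K].
  exists (flip M).
  split; [exact: cross_matching_flip|exact: flip_sub|exact: card_flip|].
  by left=> _ /imsetP[q qM ->]; apply: sndK.
have pairK p1 p2 : p1 \in M -> p2 \in M -> p1.1 \in K -> p2.2 \in K -> p1 = p2.
  move=> M1 M2 K1 K2; have [neq adjE] := cM _ _ M1 M2; apply/eqP.
  by rewrite -adjE; have /forall_inP/(_ _ K2)/implyP/(_ neq) := clK _ K1.
have pq := pairK p q pM qM pK qK; rewrite -{}pq in qK.
exists M; split=> //; right; exists p => // p' p'M /orP[] p'K.
  exact: pairK.
by rewrite -(pairK p p').
Qed.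

(** * Splitting and merging cross matchings along a separation *)

Section Separation.
Variables A B : {set G}.
Hypothesis coverAB : A :|: B = setT.
Hypothesis sepAB : forall u v, u \notin B -> v \notin A -> ~~ adj u v.

(** A pair not inside [A] has a component outside [A]; as the pair is an edge, the separation puts
    its other component in [B]. *)
Lemma cross_matching_split M : cross_matching M ->
  exists M1 M2, [/\ cross_matching M1 /\ M1 \subset setX A A,
    cross_matching M2 /\ M2 \subset setX B B & #|M1| + #|M2| = #|M|].
Proof.
move=> cM; exists (M :&: setX A A), (M :\: setX A A); split; last exact: cardsID.
- by split; [apply: cross_matching_sub cM; apply: subsetIl | apply: subsetIr].
- split; first by apply: cross_matching_sub cM; apply: subsetDl.
  apply/subsetP=> p; rewrite !inE negb_and => /andP[pA pM].
  have AB x : x \notin A -> x \in B.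
    by move=> xA; have := in_setT x; rewrite -coverAB inE (negPf xA).
  have := (cM p p pM pM).2; rewrite eqxx.
  case/orP: pA => xA adjp; rewrite (AB _ xA) ?andbT /=.
    by apply: contraLR adjp => yB; rewrite adj_sym sepAB.
  by apply: contraLR adjp => yB; rewrite sepAB.
Qed.

(** First components lie strictly on their own side, so an unwanted edge between the two matchings
    must end at a second component in [A :&: B]. The last two hypotheses exclude these edges. *)
Lemma cross_matchingU M1 M2 :
    cross_matching M1 -> cross_matching M2 ->
    M1 \subset setX A A -> M2 \subset setX B B ->
    {in M1, forall p, p.1 \notin A :&: B} ->
    {in M2, forall p, p.1 \notin A :&: B} ->
    {in M1 & M2, forall p q, q.2 \in A :&: B -> ~~ adj p.1 q.2} ->
    {in M1 & M2, forall p q, p.2 \in A :&: B -> ~~ adj q.1 p.2} ->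
  cross_matching (M1 :|: M2) /\ #|M1 :|: M2| = #|M1| + #|M2|.
Proof.
move=> cM1 cM2 /subsetP sM1 /subsetP sM2 fst1 fst2 na12 na21.
have in1 p : p \in M1 -> [/\ p.1 \in A, p.2 \in A & p.1 \notin B].
  move=> pM; have := sM1 _ pM; have := fst1 _ pM; rewrite !inE.
  by move=> pK /andP[pA ->]; move: pK; rewrite pA.
have in2 p : p \in M2 -> [/\ p.1 \in B, p.2 \in B & p.1 \notin A].
  move=> pM; have := sM2 _ pM; have := fst2 _ pM; rewrite !inE.
  by move=> pK /andP[pB ->]; move: pK; rewrite pB andbT.
have neq12 p q : p \in M1 -> q \in M2 -> p != q.
  by move=> /in1[_ _ pB] /in2[qB _ _]; apply: contraNneq pB => ->.
split.
  move=> p q /setUP[pM|pM] /setUP[qM|qM]; [exact: cM1| | |exact: cM2].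
  - have [pA _ pB] := in1 _ pM; have [_ qB _] := in2 _ qM.
    split; first by apply: contraNneq pB => ->.
    rewrite (negPf (neq12 _ _ pM qM)); apply: negbTE.
    have [qA|qA] := boolP (q.2 \in A); last exact: sepAB.
    by apply: na12 => //; rewrite inE qA.
  - have [pB _ pA] := in2 _ pM; have [_ qA _] := in1 _ qM.
    split; first by apply: contraNneq pA => ->.
    rewrite eq_sym (negPf (neq12 _ _ qM pM)); apply: negbTE.
    have [qB|qB] := boolP (q.2 \in B); last by rewrite adj_sym sepAB.
    by apply: na21 => //; rewrite inE qA.
apply/eqP; rewrite (leq_card_setU M1 M2).2 disjoint_subset; apply/subsetP=> p pM1.
by rewrite !inE; apply/negP=> pM2; have := neq12 p p pM1 pM2; rewrite eqxx.
Qed.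

(* Each vertex of the clique pays for one deleted pair: a pair of [M1] ending
   there if there is one, and otherwise a pair of [M2]. *)
Lemma cross_matching_merge_avoiding M1 M2 :
    cross_matching M1 -> cross_matching M2 ->
    M1 \subset setX A A -> M2 \subset setX B B ->
    {in M1, forall p, p.1 \in A :&: B -> p.2 \in A :&: B} ->
    {in M2, forall p, p.1 \notin A :&: B} ->
  exists2 M, cross_matching M & #|M1| + #|M2| <= #|M| + #|A :&: B|.
Proof.
move=> cM1 cM2 sM1 sM2 fst1 fst2; set K := A :&: B.
pose D1 := [set p in M1 | p.2 \in K].
pose D2 := [set p in M2 | (p.2 \in K) && (p.2 \notin [set q.2 | q in M1])].
have [||||||||cM cardM] := @cross_matchingU (M1 :\: D1) (M2 :\: D2).
- exact: cross_matching_sub (subsetDl _ _) cM1.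
- exact: cross_matching_sub (subsetDl _ _) cM2.
- exact: subset_trans (subsetDl _ _) sM1.
- exact: subset_trans (subsetDl _ _) sM2.
- move=> p /setDP[pM]; rewrite inE pM; apply: contraNN; exact: fst1.
- by move=> p /setDP[pM _]; apply: fst2.
(* A surviving [q] ending in [K] shares its end with some [p'] in [M1]. Adjacency of [p.1] to that
   end would give [p = p'], but [p'] was deleted with [D1]. *)
- move=> p q /setDP[pM pD] /setDP[qM qD] qK.
  move: qD; rewrite inE qM qK /= negbK => /imsetP[p' p'M e].
  rewrite e (cM1 p p' pM p'M).2; apply: contraNneq pD => ->.
  by rewrite inE p'M -e.
- by move=> p q /setDP[pM + _] pK; rewrite inE pM pK.
exists (M1 :\: D1 :|: (M2 :\: D2)); rewrite // cardM.
have sD1 : D1 \subset M1 by apply/subsetP=> p; rewrite inE => /andP[].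
have sD2 : D2 \subset M2 by apply/subsetP=> p; rewrite inE => /andP[].
rewrite -(cardsID D1 M1) -(cardsID D2 M2) (setIidPr sD1) (setIidPr sD2).
rewrite addnACA addnC leq_add2l.
have inj2 (M D : {set G * G}) : D \subset M -> cross_matching M ->
    #|[set p.2 | p in D]| = #|D|.
  move=> sD cM'; apply: card_in_imset.
  exact: cross_matching_snd_inj (cross_matching_sub sD cM').
rewrite -(inj2 _ _ sD1 cM1) -(inj2 _ _ sD2 cM2) -cardsUI.
(* The deleted pairs have distinct ends, all in [K], so there are at most [#|K|] of them. *)
have -> : [set p.2 | p in D1] :&: [set p.2 | p in D2] = set0.
  apply/setP=> x; rewrite !inE; apply/negP=> /andP[/imsetP[p pD ->]].
  move=> /imsetP[q]; rewrite inE => /and3P[_ _ /negP qM] e; apply: qM.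
  by rewrite -e; apply: imset_f; apply: (subsetP sD1).
rewrite cards0 addn0.
apply/subset_leq_card/subsetP=> x /setUP[] /imsetP[p].
  by rewrite inE => /andP[_ pK] ->.
by rewrite inE => /and3P[_ pK _] ->.
Qed.

End Separation.

Lemma cross_matching_merge A B M1 M2 :
    (forall u v, u \notin B -> v \notin A -> ~~ adj u v) ->
    clique (A :&: B) ->
    cross_matching M1 -> cross_matching M2 ->
    M1 \subset setX A A -> M2 \subset setX B B ->
  exists2 M, cross_matching M & #|M1| + #|M2| <= #|M| + #|A :&: B|.
Proof.
move=> sepAB clK cM1 cM2 sM1 sM2.
have [N1 [cN1 sN1 <- nf1]] := cross_matching_normal_form clK cM1 sM1.
have [N2 [cN2 sN2 <- nf2]] := cross_matching_normal_form clK cM2 sM2.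
case: nf2 => [fst2|[p2 [p2N [p2K1 p2K2]] uniq2]].
  apply: (cross_matching_merge_avoiding sepAB) => // p pN pK.
  case: nf1 => [fst1|[p1 [_ [_ p1K]] uniq1]].
    by rewrite (negPf (fst1 p pN)) in pK.
  by rewrite (uniq1 p pN) ?pK.
case: nf1 => [fst1|[p1 [p1N [p1K1 p1K2]] uniq1]].
  rewrite addnC setIC; apply: (@cross_matching_merge_avoiding B A) => //.
  - by move=> u v uA vB; rewrite adj_sym sepAB.
  - by move=> p pN; rewrite setIC => pK; rewrite (uniq2 p pN) ?pK.
  - by move=> p pN; rewrite setIC fst1.
(* Both matchings have a pair inside the clique. Once [p1] and [p2] are deleted, no remaining pair
   meets it. *)
have out1 p : p \in N1 :\ p1 -> p.1 \notin A :&: B /\ p.2 \notin A :&: B.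
  move=> /setD1P[/eqP neq pN]; apply/andP; rewrite -negb_or.
  by apply/negP=> /(uniq1 _ pN).
have out2 p : p \in N2 :\ p2 -> p.1 \notin A :&: B /\ p.2 \notin A :&: B.
  move=> /setD1P[/eqP neq pN]; apply/andP; rewrite -negb_or.
  by apply/negP=> /(uniq2 _ pN).
have [||||||||cM cardM] := @cross_matchingU A B sepAB (N1 :\ p1) (N2 :\ p2).
- exact: cross_matching_sub (subsetDl _ _) cN1.
- exact: cross_matching_sub (subsetDl _ _) cN2.
- exact: subset_trans (subsetDl _ _) sN1.
- exact: subset_trans (subsetDl _ _) sN2.
- by move=> p /out1[].
- by move=> p /out2[].
- by move=> p q _ /out2[_ /negPf->].
- by move=> p q /out1[_ /negPf->].
exists (N1 :\ p1 :|: N2 :\ p2); rewrite // cardM.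
rewrite (cardsD1 p1 N1) p1N (cardsD1 p2 N2) p2N addnACA addnC leq_add2l.
(* The two deletions are paid for by the two distinct ends of [p1]. *)
have [neq _] := cN1 p1 p1 p1N p1N.
have <- : #|[set p1.1; p1.2]| = 1 + 1 by rewrite cards2 neq.
by apply: subset_leq_card; rewrite subUset !sub1set p1K1.
Qed.

End CrossMatching.

(** * Transfer along induced embeddings, and the gluing *)

Section Embedding.
Variables (H G : sgraph) (i : H -> G).
Hypothesis i_inj : injective i.
Hypothesis i_adj : forall x y, adj (i x) (i y) = adj x y.

Let ii (p : H * H) : G * G := (i p.1, i p.2).

Let ii_inj : injective ii.
Proof. by move=> [a b] [c d] [/i_inj-> /i_inj->]. Qed.

Lemma cross_matching_image (M : {set H * H}) : cross_matching M ->
  exists M' : {set G * G}, [/\ cross_matching M',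
    M' \subset setX (i @: setT) (i @: setT) & #|M'| = #|M|].
Proof.
move=> cM; exists (ii @: M); split; last exact: card_imset.
  move=> _ _ /imsetP[p pM ->] /imsetP[q qM ->] /=.
  by rewrite (inj_eq i_inj) (inj_eq ii_inj) i_adj; apply: cM.
apply/subsetP=> _ /imsetP[p _ ->].
by rewrite in_setX; apply/andP; split; apply: imset_f.
Qed.

Lemma cross_matching_preimage (M : {set G * G}) : cross_matching M ->
  M \subset setX (i @: setT) (i @: setT) ->
  exists2 M' : {set H * H}, cross_matching M' & #|M'| = #|M|.
Proof.
move=> cM /subsetP sM; exists (ii @^-1: M).
  move=> p q; rewrite !inE => pM qM.
  by rewrite -(inj_eq i_inj) -(inj_eq ii_inj) -i_adj; apply: (cM _ _ pM qM).
rewrite -(card_imset _ ii_inj); congr #|pred_of_set _|; apply/setP=> p.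
apply/imsetP/idP => [[q] + ->|pM]; first by rewrite inE.
have := sM _ pM; rewrite inE => /andP[/imsetP[x _ e1] /imsetP[y _ e2]].
have e : p = ii (x, y) by rewrite /ii /= -e1 -e2 -surjective_pairing.
by exists (x, y); rewrite // inE -e.
Qed.

End Embedding.

(** This replaces the quotient by two overlapping induced subgraphs. They are induced because an
    edge contributed by the other graph between two identified vertices joins vertices of the chosen
    cliques, which are adjacent in both graphs. *)
Lemma gluing_embeddings (r : nat) (G1 G2 G : sgraph) : is_gluing G1 G2 r G ->
  exists (i1 : G1 -> G) (i2 : G2 -> G),
    [/\ injective i1 /\ (forall x y, adj (i1 x) (i1 y) = adj x y),
        injective i2 /\ (forall x y, adj (i2 x) (i2 y) = adj x y),
        i1 @: setT :|: i2 @: setT = setT,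
        (forall u v, u \notin i2 @: setT -> v \notin i1 @: setT -> ~~ adj u v)
      & clique (i1 @: setT :&: i2 @: setT) /\
        #|i1 @: setT :&: i2 @: setT| = r].
Proof.
move=> [K1 [K2 [phi [[cl1 card1] [cl2 card2] [phi_inj phiK]]]]].
move=> [p [p_surj p_eq p_adj]].
have cliqueP (H : sgraph) (K : {set H}) x y :
    clique K -> x \in K -> y \in K -> x != y -> adj x y.
  by move=> /forall_inP cK xK yK xy; have /forall_inP/(_ _ yK)/implyP -> := cK _ xK.
pose i1 a := p (inl a); pose i2 b := p (inr b).
have i1_inj : injective i1 by move=> a b /eqP; rewrite p_eq /= => /eqP.
have i2_inj : injective i2 by move=> a b /eqP; rewrite p_eq /= => /eqP.
have i12 a b : (i1 a == i2 b) = (a \in K1) && (phi a == b) by rewrite p_eq.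
have phiK2 a : a \in K1 -> phi a \in K2 by rewrite -phiK; apply: imset_f.
have i1_adj x y : adj (i1 x) (i1 y) = adj x y.
  apply/idP/idP => [/p_adj[[a|a] [[b|b] [/eqP + /eqP + //]]]|xy].
  - by rewrite !p_eq /= => /eqP-> /eqP->.
  - rewrite !p_eq /= => /andP[xK /eqP<-] /andP[yK /eqP<-] ab.
    by apply: (cliqueP _ K1) => //; apply: contraTneq ab => ->; rewrite adj_irr.
  by apply/p_adj; exists (inl x), (inl y).
have i2_adj x y : adj (i2 x) (i2 y) = adj x y.
  apply/idP/idP => [/p_adj[[a|a] [[b|b] [/eqP + /eqP + //]]]|xy].
  - rewrite !p_eq /= => /andP[aK /eqP<-] /andP[bK /eqP<-] ab.
    apply: (cliqueP _ K2); rewrite ?phiK2 //.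
    by apply: contraTneq ab => /phi_inj-> //; rewrite adj_irr.
  - by rewrite !p_eq /= => /eqP-> /eqP->.
  by apply/p_adj; exists (inr x), (inr y).
have capE : i1 @: setT :&: i2 @: setT = i1 @: K1.
  apply/setP=> u; rewrite inE; apply/andP/imsetP => [[]|[a aK ->]].
    move=> /imsetP[a _ ->] /imsetP[b _ /eqP]; rewrite i12 => /andP[aK _].
    by exists a.
  split; first exact: imset_f.
  by apply/imsetP; exists (phi a) => //; apply/eqP; rewrite i12 aK eqxx.
exists i1, i2; split=> //.
- apply/setP=> u; rewrite !inE; have [[a|b] <-] := p_surj u.
    by rewrite -/(i1 a) imset_f.
  by rewrite -/(i2 b) orbC imset_f.
- move=> u v uB vA; apply/negP=> /p_adj[[a|a] [[b|b] [eu ev //]]] _.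
    by move: vA; rewrite -ev -/(i1 b) imset_f.
  by move: uB; rewrite -eu -/(i2 a) imset_f.
rewrite capE card_imset //; split=> //.
apply/forall_inP=> _ /imsetP[a aK ->]; apply/forall_inP=> _ /imsetP[b bK ->].
by rewrite (inj_eq i1_inj) i1_adj; apply/implyP; apply: (cliqueP _ K1).
Qed.

Theorem theorem4p1 (r : nat) (G1 G2 G : sgraph)
    (r_gt0 : 0 < r)
    (r_le1 : r <= clique_number G1) (r_le2 : r <= clique_number G2)
    (gluing : is_gluing G1 G2 r G) :
  gamma_sp G1 + gamma_sp G2 - r <= gamma_sp G <= gamma_sp G1 + gamma_sp G2.
Proof.
have [i1 [i2 [[inj1 adj1] [inj2 adj2] covAB sepAB [clK cardK]]]] :=
  gluing_embeddings gluing.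
have cardG : #|G| + r = #|G1| + #|G2|.
  have := cardsUI (i1 @: setT) (i2 @: setT).
  by rewrite covAB cardK !card_imset // !cardsT.
have [[M cM eM] maxM] := gamma_sp_cross_matching_max G.
have [[M1 cM1 eM1] maxM1] := gamma_sp_cross_matching_max G1.
have [[M2 cM2 eM2] maxM2] := gamma_sp_cross_matching_max G2.
apply/andP; split.
  (* Lower bound: a maximum cross matching of [G] splits without loss into cross matchings of the
     two graphs. *)
  have [N1 [N2 [[cN1 sN1] [cN2 sN2] cardN]]] := cross_matching_split covAB sepAB cM.
  have [L1 cL1 eL1] := cross_matching_preimage inj1 adj1 cN1 sN1.
  have [L2 cL2 eL2] := cross_matching_preimage inj2 adj2 cN2 sN2.
  have := leq_add (maxM1 _ cL1) (maxM2 _ cL2).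
  rewrite addnACA eL1 eL2 cardN -cardG -eM (addnAC _ _ r) leq_add2r.
  by rewrite leq_subLR [r + _]addnC.
have [N1 [cN1 sN1 eN1]] := cross_matching_image inj1 adj1 cM1.
have [N2 [cN2 sN2 eN2]] := cross_matching_image inj2 adj2 cM2.
(* Upper bound: merging loses at most [r] pairs, which the [r] identified vertices in [cardG]
   compensate. *)
have [N cN] := cross_matching_merge sepAB clK cN1 cN2 sN1 sN2.
rewrite cardK eN1 eN2 => leN.
have := maxM _ cN; rewrite -(leq_add2r r) cardG -eM1 -eM2.
rewrite [leqRHS]addnACA -addnA => leG.
rewrite -(leq_add2r (#|M1| + #|M2|)).
by apply: leq_trans leG; rewrite leq_add2l.
Qed.
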